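(* Let $k\ge1$ be an integer. The degrees of freedom $\Sigma^{k,0}(\mathfrak T^4)=\Sigma^{k,0}_{trace}(\mathfrak T^4)\cup\Sigma^{k,0}_{vol}(\mathfrak T^4)$ form a unisolvent set for $V_k\Lambda^0(\mathfrak T^4)=P^k(\mathfrak T^4)$.
   Context: $\mathfrak T^4=\{x\in\mathbb R^4: -1\le x_1,x_2,x_3,x_4\le 1,\ x_1+x_2+x_3+x_4\le -2\}$ is the reference pentatope (a 4-simplex with 5 vertices, 10 edges, 10 triangular faces and 5 tetrahedral facets). $P^j(\cdot)$ denotes polynomials of total degree $\le j$ on the indicated simplex (in its intrinsic affine coordinates), and $P^j=\{0\}$ for $j<0$. The trace degrees of freedom $\Sigma^{k,0}_{trace}(\mathfrak T^4)$ of $u$ are: the values of $u$ at the 5 vertices; $\int_e u\,q$ for $q\in P^{k-2}(e)$, each edge $e$; $\int_f u\,q$ for $q\in P^{k-3}(f)$, each triangular face $f$; $\int_{\mathcal F}u\,q$ for $q\in P^{k-4}(\mathcal F)$, each tetrahedral facet $\mathcal F$. The volume degrees of freedom $\Sigma^{k,0}_{vol}(\mathfrak T^4)$ are $u\mapsto\int_{\mathfrak T^4}u\,q$ for $q\in P^{k-5}(\mathfrak T^4)$. Unisolvent means: the number of degrees of freedom (counting a basis of each test space $q$) equals $\dim V_k\Lambda^0(\mathfrak T^4)$, and the only $u\in V_k\Lambda^0(\mathfrak T^4)$ on which all of them vanish is $u=0$. *)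

(* Defs.v *)
From HB Require Import structures.
From mathcomp Require Import all_boot all_order all_algebra.
(* the notations of mpoly clash with those of analysis *)
From mathcomp Require Import -(notations) mpoly.
From mathcomp Require Import all_classical all_reals all_analysis.
From mathcomp Require Import ring lra.

Set Implicit Arguments.
Unset Strict Implicit.
Unset Printing Implicit Defensive.
Import Order.TTheory GRing.Theory Num.Theory.

Local Open Scope classical_set_scope.
Local Open Scope ring_scope.

(* The bound is an integer: for j < 0 only the zero polynomial, whose support
   is empty, has degree at most j. *)
Definition deg_le (n : nat) (R : nzRingType) (j : int)
    : {pred mpoly n R} :=
  fun p => all (fun m => (mdeg m)%:Z <= j) (msupp p).

Lemma deg_le_submod_closed n (R : nzRingType) j :
  submod_closed (@deg_le n R j).
Proof.
split=> [|c p q]; first by rewrite unfold_in /deg_le msupp0.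
rewrite !unfold_in /deg_le => /allP hp /allP hq.
apply/allP => m /msuppD_le; rewrite mem_cat => /orP[/msuppZ_le|].
  exact: hp.
exact: hq.
Qed.

HB.instance Definition _ n (R : nzRingType) j :=
  GRing.isSubmodClosed.Build R (mpoly n R) (@deg_le n R j)
    (@deg_le_submod_closed n R j).

Record Pol (R : nzRingType) (n : nat) (j : int) : predArgType :=
  MkPol { mpoly_of_Pol :> mpoly n R; _ : mpoly_of_Pol \in deg_le j }.

HB.instance Definition _ (R : nzRingType) n j :=
  [isSub for @mpoly_of_Pol R n j].
HB.instance Definition _ (R : nzRingType) n j := [Choice of Pol R n j by <:].
HB.instance Definition _ (R : nzRingType) n j :=
  [SubChoice_isSubLmodule of Pol R n j by <:].

(* The monomials of degree <= j form the finite type 'X_{1..n < deg_bound j} *)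
Definition deg_bound (j : int) : nat := if j is Posz i then i.+1 else 0%N.

Lemma deg_boundP i j : ((Posz i <= j) = (i < deg_bound j)%N)%R.
Proof. by case: j => j. Qed.

Section PolVector.
Variables (R : nzRingType) (n : nat) (j : int).
Let I : finType := bmultinom n (deg_bound j).
Let mon (i : 'I_#|I|) : multinom n := bmnm (enum_val i).

Lemma Pol_vecaxiom : Vector.axiom #|I| (Pol R n j).
Proof.
have mon_inj : injective mon by move=> a b /val_inj /enum_val_inj.
exists (fun p => \row_i mcoeff (mon i) (val p)) => [c p q|].
  by apply/rowP => i; rewrite !mxE mcoeffD mcoeffZ.
pose g (r : 'rV[R]_#|I|) : mpoly n R :=
  \sum_i r 0 i *: mpolyX R (mon i).
have gE r i : mcoeff (mon i) (g r) = r 0 i.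
  rewrite raddf_sum /= (bigD1 i)//= mcoeffZ mcoeffX eqxx mulr1.
  rewrite big1 ?addr0// => k ki; rewrite mcoeffZ mcoeffX.
  by rewrite (inj_eq mon_inj) (negbTE ki) mulr0.
have g_deg r : g r \in deg_le j.
  rewrite rpred_sum// => i _; apply: rpredZ.
  rewrite unfold_in /deg_le msuppX /= andbT deg_boundP.
  exact: (valP (enum_val i)).
exists (fun r => MkPol (g_deg r)) => [p|r]; last first.
  by apply/rowP => i; rewrite mxE gE.
apply/val_inj/mpolyP => m /=.
have [mj|mj] := boolP (mdeg m < deg_bound j)%N.
  have -> : m = mon (enum_rank (BMultinom mj : I)).
    by rewrite /mon enum_rankK.
  by rewrite gE mxE.
have coef0 (q : Pol R n j) : mcoeff m (val q) = 0.
  apply/eqP; rewrite mcoeff_eq0; apply/negP => mq.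
  by have /allP/(_ _ mq) := valP q; rewrite deg_boundP (negbTE mj).
by rewrite -[g _]/(val (MkPol (g_deg _))) !coef0.
Qed.

HB.instance Definition _ := Lmodule_hasFinDim.Build R (Pol R n j) Pol_vecaxiom.

End PolVector.

Definition peval (R : comNzRingType) n j (p : Pol R n j) (x : 'I_n -> R) : R :=
  meval x p.

Section LebesgueTuple.
Variable R : realType.
Local Notation T := (measurableTypeR R).

Definition tcons n (x : T * n.-tuple T) : n.+1.-tuple T :=
  [tuple of x.1 :: x.2].

Lemma measurable_tcons n : measurable_fun [set: T * n.-tuple T] (@tcons n).
Proof.
exact: (measurable_cons measurable_fst measurable_snd).
Qed.

Let tuncons n (t : n.+1.-tuple T) : T * n.-tuple T :=
  (thead t, [tuple of behead t]).

Let measurable_tuncons n : measurable_fun [set: n.+1.-tuple T] (@tuncons n).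
Proof.
apply: measurable_fun_pair => /=; first exact: measurable_tnth.
exact: measurable_behead.
Qed.

Let tconsK n : cancel (@tcons n) (@tuncons n).
Proof.
by move=> [x t]; rewrite /tuncons/= theadE; congr pair; apply/val_inj.
Qed.

Let tunconsK n : cancel (@tuncons n) (@tcons n).
Proof. by move=> t; rewrite [RHS]tuple_eta. Qed.

Section step.
Variables (n : nat) (m : {sigma_finite_measure set (n.-tuple T) -> \bar R}).

(* The product of the Lebesgue measure on R and m, carried to R^n.+1 *)
Definition lebesgue_step : set (n.+1.-tuple T) -> \bar R :=
  pushforward (@lebesgue_measure R \x m)%E (@tcons n).

Let step0 : lebesgue_step set0 = 0%E.
Proof. by rewrite /lebesgue_step /pushforward preimage_set0 measure0. Qed.

Let step_ge0 A : (0 <= lebesgue_step A)%E.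
Proof. by rewrite /lebesgue_step /pushforward; apply: measure_ge0. Qed.

Let step_sigma_additive : semi_sigma_additive lebesgue_step.
Proof.
move=> F mF tF mUF; rewrite /lebesgue_step /pushforward preimage_bigcup.
have mP A : measurable A -> measurable (@tcons n @^-1` A).
  by move=> mA; rewrite -[X in measurable X]setTI; exact: measurable_tcons.
apply: measure_semi_sigma_additive.
- by move=> i; exact: mP.
- apply/trivIsetP => /= i j _ _ ij; rewrite -preimage_setI.
  by move/trivIsetP : tF => /(_ _ _ _ _ ij) ->//; rewrite preimage_set0.
- by rewrite -preimage_bigcup; exact: mP.
Qed.

HB.instance Definition _ := isMeasure.Build _ _ _ lebesgue_step
  step0 step_ge0 step_sigma_additive.

Let step_sigma_finite : sigma_finite setT lebesgue_step.
Proof.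
have /sigma_finiteP[F [FT ndF Foo]] := sigma_finiteT (@lebesgue_measure R).
have /sigma_finiteP[G [GT ndG Goo]] := sigma_finiteT m.
exists (fun i => @tuncons n @^-1` (F i `*` G i)).
  rewrite -preimage_bigcup (_ : \bigcup_i _ = setT) ?preimage_setT//.
  apply/seteqP; split => // -[x t] _.
  have [i _ Fx] : (\bigcup_i F i) x by rewrite -FT.
  have [j _ Gt] : (\bigcup_i G i) t by rewrite -GT.
  exists (maxn i j) => //; split.
    by move: x Fx; exact/subsetPset/ndF/leq_maxl.
  by move: t Gt; exact/subsetPset/ndG/leq_maxr.
move=> i; have [mF Fi] := Foo i; have [mG Gi] := Goo i; split.
  rewrite -[X in measurable X]setTI; apply: measurable_tuncons => //.
  exact: measurableX.
rewrite /lebesgue_step /pushforward (_ : _ @^-1` _ = F i `*` G i).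
  by rewrite product_measure1E// lte_mul_pinfty// ge0_fin_numE.
by apply/funext => x; rewrite /preimage /mkset tconsK.
Qed.

HB.instance Definition _ := Measure_isSigmaFinite.Build _ _ _ lebesgue_step
  step_sigma_finite.

End step.

Fixpoint lebesgue_tuple n : {sigma_finite_measure set (n.-tuple T) -> \bar R} :=
  if n is n'.+1 then lebesgue_step (lebesgue_tuple n')
  else dirac ([tuple] : 0.-tuple T).

(* This characterizes n-dimensional Lebesgue measure on the Borel sets. *)
Lemma lebesgue_tuple_box n (A : 'I_n -> set T) :
  (forall i, measurable (A i)) ->
  lebesgue_tuple n [set t | forall i, A i (tnth t i)] =
  (\prod_(i < n) @lebesgue_measure R (A i))%E.
Proof.
elim: n A => [|n IH] A mA.
  rewrite big_ord0 /= diracE mem_set// => i; by case: i.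
have mbox m (B : 'I_m -> set T) : (forall i, measurable (B i)) ->
    measurable [set t : m.-tuple T | forall i, B i (tnth t i)].
  move=> mB; rewrite (_ : mkset _ =
      \bigcap_(i in [set: 'I_m]) ((fun t => tnth t i) @^-1` B i)).
    apply: fin_bigcap_measurable => // i _.
    by rewrite -[X in measurable X]setTI; exact: measurable_tnth.
  by apply/seteqP; split => t /= h i; [move=> _|]; exact: h.
rewrite big_ord_recl -IH//= /lebesgue_step /pushforward.
rewrite -product_measure1E; [|exact: mA|by apply: (mbox n (fun i => A (lift ord0 i)))].
congr (_ _); apply/seteqP; split => -[x t] /= h.
  split; first exact: (h ord0).
  by move=> i; have := h (lift ord0 i); rewrite tnthS.
by move=> i; case: (unliftP ord0 i) => [j|] ->; [rewrite tnthS; exact: h.2|exact: h.1].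
Qed.

End LebesgueTuple.

Arguments lebesgue_tuple R n : clear implicits.

Section Pentatope.
Variable R : realType.
Local Notation T := (measurableTypeR R).

Definition pentatope : set (4.-tuple T) :=
  [set x | (forall i, -1 <= (tnth x i : R) <= 1) /\
           \sum_i (tnth x i : R) <= -2].

(* Vertex 0 is (-1, -1, -1, -1); vertex c + 1 has the c-th coordinate 1. *)
Definition vertex (i : 'I_5) (c : 'I_4) : R :=
  if i == lift ord0 c then 1 else -1.

Lemma pentatope_hull (x : 4.-tuple T) :
  pentatope x <-> exists l : 'I_5 -> R,
    [/\ forall i, 0 <= l i, \sum_i l i = 1
      & forall c, tnth x c = \sum_i l i * vertex i c :> R].
Proof.
have vE (l : 'I_5 -> R) c :
    \sum_i l i * vertex i c = 2 * l (lift ord0 c) - \sum_i l i.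
  rewrite (bigD1 (lift ord0 c))//= [in RHS](bigD1 (lift ord0 c))//=.
  rewrite /vertex eqxx mulr1 (eq_bigr (fun i => - l i)) => [|i /negbTE ->].
    by rewrite sumrN; ring.
  by rewrite mulrN1.
split=> [[xb]|[l [l0 l1 lx]]].
  set s := \sum_i _ => xs.
  exists (fun i => if unlift ord0 i is Some c then (tnth x c + 1) / 2
                   else (- 2 - s) / 2); split.
  - move=> i; case: unliftP => [c _|_]; last lra.
    by have /andP[] := xb c; lra.
  - rewrite big_ord_recl unlift_none.
    under eq_bigr do rewrite liftK.
    rewrite -mulr_suml big_split/= sumr_const card_ord -/s; lra.
  - move=> c; rewrite vE liftK big_ord_recl unlift_none.
    under eq_bigr do rewrite liftK.
    rewrite -mulr_suml big_split/= sumr_const card_ord -/s; lra.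
have lle i : l i <= 1.
  by rewrite -l1 (bigD1 i)//= lerDl sumr_ge0.
split=> [c|].
  rewrite lx vE l1; have := l0 (lift ord0 c); have := lle (lift ord0 c); lra.
under eq_bigr do rewrite lx vE l1.
rewrite big_split/= -mulr_sumr sumr_const card_ord.
have := l0 ord0; move: l1; rewrite big_ord_recl; lra.
Qed.

(* A d-dimensional face is given by its d + 1 vertices. *)
Definition face (d : nat) : finType := {F : {set 'I_5} | #|F| == d.+1}.

Definition face_vertex d (F : face d) (i : nat) : 'I_5 :=
  nth ord0 (enum (val F)) i.

(* The rows are the edge vectors of the face issued from its first vertex. *)
Definition face_mx d (F : face d) : 'M[R]_(d, 4) :=
  \matrix_(i, c) (vertex (face_vertex F i.+1) c - vertex (face_vertex F 0) c).

Definition face_point d (F : face d) (t : d.-tuple T) (c : 'I_4) : R :=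
  vertex (face_vertex F 0) c + \sum_i tnth t i * face_mx F i c.

Definition std_simplex (d : nat) : set (d.-tuple T) :=
  [set t | (forall i, 0 <= (tnth t i : R)) /\ \sum_i (tnth t i : R) <= 1].

(* Surface integral over F of the function whose expression in the affine
   coordinates t of F is g; the factor is the Jacobian of face_point F. *)
Definition face_integral d (F : face d) (g : d.-tuple T -> R) : R :=
  Num.sqrt (\det (face_mx F *m (face_mx F)^T)) *
  \int[lebesgue_tuple R d]_(t in @std_simplex d) g t.

Definition vertex_dofs k : seq (Pol R 4 k -> R) :=
  [seq (fun u => peval u (vertex i)) | i <- enum 'I_5].

(* B F is meant to be a basis of the test space P^j(F), whose elements are
   polynomials in the affine coordinates of F. *)
Definition face_dofs k d j (B : face d -> seq (Pol R d j)) :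
    seq (Pol R 4 k -> R) :=
  [seq (fun u => face_integral F
                   (fun t => peval u (face_point F t) * peval q (tnth t)))
  | F <- enum {: face d}, q <- B F].

Definition trace_dofs k
    (Be : face 1 -> seq (Pol R 1 (k - 2)))
    (Bf : face 2 -> seq (Pol R 2 (k - 3)))
    (BF : face 3 -> seq (Pol R 3 (k - 4))) : seq (Pol R 4 k -> R) :=
  vertex_dofs k ++ face_dofs k Be ++ face_dofs k Bf ++ face_dofs k BF.

Definition vol_dofs k (B : seq (Pol R 4 (k - 5))) : seq (Pol R 4 k -> R) :=
  [seq (fun u => \int[lebesgue_tuple R 4]_(x in pentatope)
                   (peval u (tnth x) * peval q (tnth x))) | q <- B].

End Pentatope.

(* L lists the degrees of freedom, one for each basis element of each test
   space, so that size L is their number. *)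
Definition unisolvent (R : realType) (V : vectType R) (L : seq (V -> R)) : Prop :=
  size L = \dim {: V} /\ forall u : V, all (fun l => l u == 0) L -> u = 0.

(* Main.v *)
Require Import Defs.
From mathcomp Require Import all_boot all_order all_algebra.
From mathcomp Require Import -(notations) mpoly.
From mathcomp Require Import all_classical all_reals all_analysis.
From mathcomp Require Import measurable_realfun.
From mathcomp Require Import ring lra zify.

Set Implicit Arguments.
Unset Strict Implicit.
Unset Printing Implicit Defensive.
Import Order.TTheory GRing.Theory Num.Theory.

Local Open Scope ring_scope.

(** The count is Vandermonde's identity.  A polynomial space of degree
    at most k - d - 1 in d variables has dimension 'C(k - 1, d), and there are
    'C(5, d + 1) faces of dimension d, so the degrees of freedom number
    sum_d 'C(5, d + 1) * 'C(k - 1, d) = 'C(k + 4, 4), the dimension of the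
    polynomials of degree at most k in four variables ([size_dofs]).

    For the injectivity, let all degrees of freedom of u vanish.  By induction
    on the dimension of the face, u vanishes on the whole affine hull of every
    face; the vertices start the induction.  For a face of dimension d, pull u
    back to a polynomial p in d variables.  By induction p vanishes on each of
    the d + 1 hyperplanes that bound the simplex, so p = (\prod_i l_i) * q with
    l_i the affine forms of these hyperplanes ([prod_simplex_form_dvd]), and q
    has degree at most k - d - 1.  Hence q is one of the test functions of the
    face, and the integral of p * q = (\prod_i l_i) * q ^+ 2 over the simplex is
    zero.  This product is nonnegative on the simplex, so it is the zero
    polynomial ([mpoly_ge0_integral_eq0]), and therefore q = 0 and p = 0
    ([simplex_unisolvent]).  The last step of the induction is the pentatope
    itself, where p = u.

    The faces are integrated over {t | 0 <= t_i, \sum_i t_i <= 1} and the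
    pentatope is {x | -1 <= x_i, \sum_i x_i <= -2}, so the argument is carried
    out once, for all simplices {t | c <= t_i, \sum_i t_i <= s}.  Which points
    of a face lie on which of its facets is read off barycentric coordinates
    ([bary]). *)

(** * The number of degrees of freedom *)

(** Listing the exponents identifies the monomials of degree at most D with the
    n-tuples of numbers of sum at most D, which [card_partial_ord_partitions]
    counts. *)
Lemma card_bmultinom n D : #|{: bmultinom n D.+1}| = 'C(n + D, n).
Proof.
rewrite -card_partial_ord_partitions -cardsT.
pose f (m : bmultinom n D.+1) : n.-tuple 'I_D.+1 :=
  [tuple inord (bmnm m i) | i < n].
have fE m i : (tnth (f m) i : nat) = bmnm m i.
  rewrite tnth_mktuple inordK// (leq_ltn_trans _ (bmdeg m))// mdegE.
  by rewrite (bigD1 i)//= leq_addr.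
have f_inj : injective f.
  by move=> a b fab; apply/val_inj/mnmP => i; rewrite -!fE fab.
rewrite -(card_imset _ f_inj); apply: eq_card => t; rewrite inE.
apply/imsetP/idP => [[m _ ->]|tD].
  rewrite big_tuple -ltnS; apply: leq_ltn_trans (bmdeg m).
  rewrite mdegE; apply: leq_sum => i _; exact/eq_leq/fE.
pose m := Multinom [tuple (tnth t i : nat) | i < n].
have mD : (mdeg m < D.+1)%N.
  rewrite ltnS mdegE; apply: leq_trans tD; rewrite big_tuple.
  by apply: leq_sum => i _; rewrite multinomE tnth_mktuple.
exists (BMultinom mD) => //; apply: eq_from_tnth => i.
by apply: ord_inj; rewrite fE /= multinomE tnth_mktuple.
Qed.

Lemma dim_Pol (R : realType) n (j : int) :
  \dim {: Pol R n j} = if j is Posz D then 'C(n + D, n) else 0%N.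
Proof.
rewrite dimvf /dim /=; case: j => j /=; first exact: card_bmultinom.
by apply: eq_card0 => -[m].
Qed.

(** With k.+1 the degree of the element, this is the size of the test space on
    each n-dimensional face; the formula covers the degrees that are negative,
    where both sides are zero. *)
Lemma dim_Pol_sub (R : realType) n k :
  \dim {: Pol R n (k.+1%:Z - n.+1%:Z)} = 'C(k, n).
Proof.
rewrite dim_Pol; have [nk|kn] := leqP n k.
  have -> : k.+1%:Z - n.+1%:Z = (k - n)%N%:Z by lia.
  by rewrite subnKC.
have -> : k.+1%:Z - n.+1%:Z = Negz (n - k).-1 by rewrite NegzE; lia.
by rewrite bin_small.
Qed.

Lemma size_basis_of (K : fieldType) (V : vectType K) (U : {vspace V}) (X : seq V) :
  basis_of U X -> size X = \dim U.
Proof. by rewrite -[X]in_tupleE => /vector.size_basis ->. Qed.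

Lemma card_face d : #|{: face d}| = 'C(5, d.+1).
Proof.
rewrite card_sig -[in RHS](card_ord 5) -card_draws.
by apply: eq_card => A; rewrite !inE.
Qed.

Lemma size_face_dofs (R : realType) k d j (B : face d -> seq (Pol R d j)) :
  (forall F, basis_of {: Pol R d j} (B F)) ->
  size (@face_dofs R k d j B) = ('C(5, d.+1) * \dim {: Pol R d j})%N.
Proof.
move=> hB; rewrite /face_dofs size_allpairs_dep sumnE big_map big_enum /=.
rewrite (eq_bigr (fun=> \dim {: Pol R d j})) => [|F _]; last first.
  exact: size_basis_of.
by rewrite sum_nat_const card_face.
Qed.

Lemma size_dofs (R : realType) (k : nat) (hk : (1 <= k)%N)
    (Be : face 1 -> seq (Pol R 1 (k%:Z - 2)))
    (Bf : face 2 -> seq (Pol R 2 (k%:Z - 3)))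
    (BF : face 3 -> seq (Pol R 3 (k%:Z - 4)))
    (B : seq (Pol R 4 (k%:Z - 5)))
    (hBe : forall e, basis_of {: Pol R 1 (k%:Z - 2)} (Be e))
    (hBf : forall f, basis_of {: Pol R 2 (k%:Z - 3)} (Bf f))
    (hBF : forall F, basis_of {: Pol R 3 (k%:Z - 4)} (BF F))
    (hB : basis_of {: Pol R 4 (k%:Z - 5)} B) :
  size (trace_dofs Be Bf BF ++ vol_dofs B : seq (Pol R 4 k%:Z -> R))
  = \dim {: Pol R 4 k%:Z}.
Proof.
case: k hk Be Bf BF B hBe hBf hBF hB => // k _ Be Bf BF B hBe hBf hBF hB.
have sv : size (vertex_dofs R k.+1) = 5%N by rewrite size_map -cardT card_ord.
rewrite /trace_dofs /vol_dofs !size_cat sv size_map.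
rewrite !size_face_dofs// (size_basis_of hB).
rewrite (dim_Pol_sub R 1) (dim_Pol_sub R 2) (dim_Pol_sub R 3) (dim_Pol_sub R 4).
(* Vandermonde's terms contain 'C(5, 4 - d), the number of faces of
   dimension d by the symmetry of binomial coefficients. *)
rewrite dim_Pol (_ : 4 + k.+1 = k + 5)%N; last by rewrite addnC addSnnS.
rewrite -binomial.Vandermonde !big_ord_recr big_ord0 /= !subSS !subn0 !bin0 !bin1.
by rewrite (_ : 'C(5, 4) = 5)// (_ : 'C(5, 3) = 10)// (_ : 'C(5, 2) = 10)//; lia.
Qed.

(** * Polynomials that vanish on a grid *)

Local Notation widen := (widen_ord (leqnSn _)).

Lemma coef_muni (R : nzRingType) n (p : mpoly n.+1 R) (m : multinom n.+1) :
  mcoeff (Multinom [tuple m (widen i) | i < n]) (muni p)`_(m ord_max) =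
  mcoeff m p.
Proof.
rewrite muniE coef_sum raddf_sum [in RHS](mpolyE p) raddf_sum /=.
apply: eq_bigr => m2 _; rewrite coefZ coefXn mcoeffZ mcoeffX.
rewrite mulr_natr mulrb (fun_if (mcoeff _)) mcoeffZ mcoeffX mcoeff0.
have [->|nm] := eqVneq m2 m; first by rewrite !eqxx.
case: eqP => [mm|]; last by rewrite mulr0.
case: eqP => [/mnmP mw|]; last by [].
case/eqP: nm; apply/mnmP => i; case: (unliftP ord_max i) => [j|] ->; last by [].
have := mw j; rewrite !multinomE !tnth_mktuple.
by congr (_ = _); congr (fun_of_multinom _ _); apply: val_inj; rewrite /= /bump leqNgt ltn_ord.
Qed.

Lemma horner_muni (R : comNzRingType) n (v : 'I_n.+1 -> R) (p : mpoly n.+1 R) :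
  (map_poly (meval (fun i => v (widen i))) (muni p)).[v ord_max] = meval v p.
Proof.
rewrite muniE raddf_sum horner_sum mevalE /=; apply: eq_bigr => m _.
rewrite map_polyZ map_polyXn /= mevalZ mevalX !hornerE big_ord_recr /= mulrA.
congr (_ * _ * _); apply: eq_bigr => i _.
by rewrite multinomE tnth_mktuple.
Qed.

(** Induction on the number of variables: with all variables but the last fixed
    on the grid, p is a polynomial in one variable with infinitely many roots,
    so its coefficients, polynomials in the other variables, vanish on the
    grid. *)
Lemma mpoly_eq0_grid (R : idomainType) (f : nat -> R) n (p : mpoly n R) :
  injective f -> (forall e : 'I_n -> nat, meval (fun i => f (e i)) p = 0) ->
  p = 0.
Proof.
move=> f_inj; elim: n p => [|n IH] p p0.
  have pC : p = mpolyC 0 (mcoeff mnm0 p).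
    apply: msize1_polyC; rewrite msizeE; apply/bigmax_leqP_seq => m _ _.
    by rewrite mdegE big_ord0.
  have := p0 (fun=> 0%N); rewrite pC mevalC => ->; exact: mpolyC0.
suff muni0 : muni p = 0.
  by apply/mpolyP => m; rewrite -coef_muni muni0 coef0 !mcoeff0.
apply/polyP => k; rewrite coef0; apply: IH => e.
set Q := map_poly (meval (fun i => f (e i))) (muni p).
suff Q0 : Q = 0 by rewrite -coef_map -/Q Q0 coef0.
apply/eqP/negPn/negP => Qn0.
suff /(max_poly_roots Qn0) : all (root Q) (mkseq f (size Q)).
  by rewrite mkseq_uniq// size_mkseq ltnn => /(_ isT).
apply/allP => _ /mapP[j _ ->].
pose e' i := if unlift ord_max i is Some i' then e i' else j.
have e'w i : e' (widen i) = e i.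
  rewrite /e' (_ : widen i = lift ord_max i) ?liftK//.
  by apply: val_inj; rewrite /= /bump leqNgt ltn_ord.
have := horner_muni (fun i => f (e' i)) p.
rewrite p0 {2}/e' unlift_none => h; apply/rootP; rewrite -[RHS]h.
by congr (_.[_]); apply: eq_map_poly => c; apply: meval_eq => i; rewrite e'w.
Qed.

(** * Divisibility by affine forms *)

Local Notation var i := (mpolyX _ (mnm1 i)).
Local Notation subst h := (comp_mpoly [tuple h i | i < _]).

Lemma mpoly_eq0_fun (R : numDomainType) n (p : mpoly n R) :
  (forall x, meval x p = 0) -> p = 0.
Proof.
by move=> p0; apply: (mpoly_eq0_grid (f := fun i => i%:R)) => // i j /eqP;
  rewrite eqr_nat => /eqP.
Qed.

Lemma meval_subst (R : comNzRingType) n k (h : 'I_n -> mpoly k R) x p :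
  meval x (subst h p) = meval (fun i => meval x (h i)) p.
Proof.
by rewrite comp_mpoly_meval; apply: meval_eq => i; rewrite tnth_mktuple.
Qed.

Lemma subst_var (R : comNzRingType) n (p : mpoly n R) : subst (fun i => var i) p = p.
Proof. exact: comp_mpoly_id. Qed.

(** Congruence modulo the ideal generated by l is compatible with the ring
    operations, hence with substitution into a polynomial. *)
Lemma subst_congr (R : comNzRingType) n k (l : mpoly k R)
    (f g : 'I_n -> mpoly k R) p :
  (forall i, exists c, f i - g i = l * c) ->
  exists c, subst f p - subst g p = l * c.
Proof.
move=> fg; pose D a b := exists c, a - b = l * c.
have Dxx a : D a a by exists 0; rewrite subrr mulr0.
have DD a b a' b' : D a b -> D a' b' -> D (a + a') (b + b').
  by move=> [c abc] [c' abc']; exists (c + c'); rewrite mulrDr -abc -abc'; ring.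
have DM a b a' b' : D a b -> D a' b' -> D (a * a') (b * b').
  move=> [c abc] [c' abc']; exists (c * a' + b * c').
  by rewrite mulrDr mulrA -abc mulrCA -abc'; ring.
rewrite !comp_mpolyEX -/(D _ _); apply: big_ind2 => // m _.
rewrite -!mul_mpolyC; apply: (DM) => //; rewrite !comp_mpolyX.
apply: big_ind2 => // i _; rewrite !tnth_mktuple.
by elim: (m i) => [|e IH]; rewrite ?expr0// !exprS; apply: (DM) => //; apply: fg.
Qed.

(** The point x - l_i(x) w_i is the projection of x onto the hyperplane
    l_i = 0 along w_i.  Substituting it is a ring morphism s_i, with
    q - s_i(q) a multiple of l_i for every q; so l_i divides q as soon as
    s_i(q) = 0.  If the product of some other forms has been factored out of
    p, applying s_i to p = (\prod l) * q gives s_i(q) = 0, since polynomials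
    form an integral domain in which s_i(l) != 0: the separating point, fixed
    by the projection, shows it. *)
Lemma prod_dvd_mpoly (R : numDomainType) n (I : finType)
    (l : I -> mpoly n R) (w : I -> 'I_n -> R) (p : mpoly n R) :
  (forall i x, meval (fun m => x m - w i m * meval x (l i)) (l i) = 0) ->
  (forall i j, i != j -> exists2 x, meval x (l j) = 0 & meval x (l i) != 0) ->
  (forall i x, meval x (l i) = 0 -> meval x p = 0) ->
  exists q, p = (\prod_i l i) * q.
Proof.
move=> proj sep p0; rewrite -big_enum /=; have := enum_uniq I.
elim: (enum I) => [_|j r IH /= /andP[jr /IH[q pq]]].
  by exists p; rewrite big_nil mul1r.
pose s m := var m - mpolyC _ (w j m) * l j.
have ev_s x i : meval x (s i) = x i - w j i * meval x (l j).
  by rewrite mevalB mevalM mevalXU mevalC.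
have [c qc] : exists c, q - subst s q = l j * c.
  rewrite -{1}[q]subst_var; apply: subst_congr => i.
  by exists (mpolyC _ (w j i)); rewrite /s opprB addrC subrK mulrC.
suff sq0 : subst s q = 0.
  by exists c; rewrite pq big_cons mulrAC -qc sq0 subr0 mulrC.
have : subst s p = 0.
  apply: mpoly_eq0_fun => x; rewrite meval_subst; apply: (p0 j).
  by rewrite (meval_eq (v2 := fun m => x m - w j m * meval x (l j))).
rewrite pq rmorphM rmorph_prod => /eqP; rewrite mulf_eq0 => /orP[|/eqP//].
rewrite prodf_seq_eq0 => /hasP[i ir /eqP sl0].
(* At a point of the hyperplane l_j = 0, s does not change the value. *)
have [x xj /eqP[]] : exists2 x, meval x (l j) = 0 & meval x (l i) != 0.
  by apply: sep; apply: contraNneq jr => <-.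
transitivity (meval x (subst s (l i))); last by rewrite sl0 meval0.
by rewrite meval_subst; apply: meval_eq => m; rewrite ev_s xj mulr0 subr0.
Qed.

(** * Degrees *)

Lemma msize_prod_linear (R : idomainType) n (I : finType) (l : I -> mpoly n R) q :
  (forall i, msize (l i) = 2) -> q != 0 ->
  msize (\prod_i l i * q) = (#|I| + msize q)%N.
Proof.
move=> l2 q0; rewrite -big_enum cardE /=.
have ln0 i : l i != 0 by rewrite -msize_poly_eq0 l2.
elim: (enum I) => [|i r IH]; first by rewrite big_nil mul1r.
rewrite big_cons -mulrA msizeM// ?IH ?l2//.
apply: mulf_neq0 => //; rewrite prodf_seq_neq0; apply/allP => j _ /=.
exact: ln0.
Qed.

Lemma deg_le_msize (R : nzRingType) n (j : int) (p : mpoly n R) :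
  (p \in deg_le j) = (msize p <= deg_bound j)%N.
Proof.
rewrite unfold_in /deg_le msizeE; apply/allP/bigmax_leqP_seq => h m mp.
  by move=> _; rewrite -deg_boundP; apply: h.
by rewrite deg_boundP; apply: h.
Qed.

Lemma deg_leM (R : idomainType) n (i j : nat) (p q : mpoly n R) :
  p \in deg_le i -> q \in deg_le j -> p * q \in deg_le (i + j)%N.
Proof.
have [->|p0] := eqVneq p 0; first by move=> _ _; rewrite mul0r rpred0.
have [->|q0] := eqVneq q 0; first by move=> _ _; rewrite mulr0 rpred0.
by rewrite !deg_le_msize /= msizeM// => hp hq; lia.
Qed.

Lemma deg_le_subst (R : idomainType) n k (h : 'I_n -> mpoly k R) (j : nat) p :
  (forall i, h i \in deg_le 1) -> p \in deg_le j -> subst h p \in deg_le j.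
Proof.
move=> h1 pj; rewrite comp_mpolyEX big_seq; apply: rpred_sum => m mp.
apply: rpredZ; rewrite comp_mpolyX.
have mj : (mdeg m <= j)%N by have /allP /(_ _ mp) := pj.
suff : \prod_(i < n) tnth [tuple h i | i < n] i ^+ m i \in deg_le (mdeg m).
  by rewrite !deg_le_msize /=; lia.
have one : (1 : mpoly k R) \in deg_le 0 by rewrite deg_le_msize msize1.
rewrite mdegE; apply: (big_rec2 (fun a (b : nat) => a \in deg_le b)) => //.
move=> i b a _ ab; apply: deg_leM => //; rewrite tnth_mktuple.
elim: (m i) => [|e IH]; first by rewrite expr0.
by rewrite exprS; apply: (@deg_leM _ _ 1%N).
Qed.

Lemma deg_le_var (R : nzRingType) n (i : 'I_n) : (var i : mpoly n R) \in deg_le 1.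
Proof. by rewrite deg_le_msize msizeX mdeg1. Qed.

Lemma deg_leC (R : nzRingType) n (c : R) (j : nat) : mpolyC n c \in deg_le j.
Proof. by rewrite deg_le_msize msizeC /=; case: (c != 0). Qed.

Lemma msize_nonconstant (R : nzRingType) n (l : mpoly n R) x y :
  l \in deg_le 1 -> meval x l != meval y l -> msize l = 2.
Proof.
rewrite deg_le_msize /= => l2; apply: contraNeq => nl2.
have /msize1_polyC -> : (msize l <= 1)%N by rewrite -ltnS ltn_neqAle nl2.
by rewrite !mevalC.
Qed.

(** * Integrals of polynomials over a simplex *)

Import numFieldNormedType.Exports.

Section SimplexIntegral.
Local Open Scope classical_set_scope.
Variable R : realType.
Local Notation T := (measurableTypeR R).

(** The choice c = 0, s = 1 gives the domain of the affine coordinates of a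
    face, and c = -1, s = -2 gives the pentatope. *)
Definition simplex n (c s : R) : set (n.-tuple T) :=
  [set t | (forall i, c <= (tnth t i : R)) /\ \sum_i (tnth t i : R) <= s].
Arguments simplex : clear implicits.

Definition box n (A : 'I_n -> set T) : set (n.-tuple T) :=
  [set t | forall i, A i (tnth t i)].

Lemma measurable_box n (A : 'I_n -> set T) :
  (forall i, measurable (A i)) -> measurable (box A).
Proof.
move=> mA; rewrite (_ : box _ =
    \bigcap_(i in [set: 'I_n]) ((fun t => tnth t i) @^-1` A i)).
  apply: fin_bigcap_measurable => // i _.
  by rewrite -[X in measurable X]setTI; exact: measurable_tnth.
by apply/seteqP; split => t h i; [move=> _|]; exact: h.
Qed.

(** The coordinates other than the i-th add up to at least c *+ n.-1. *)
Lemma simplex_sub_box n c s :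
  simplex n c s `<=` box (fun _ : 'I_n => `[c, s - c *+ n.-1]).
Proof.
move=> t [ct ts] i; rewrite /= in_itv /= ct /= lerBrDr.
apply: le_trans ts; rewrite [leRHS](bigD1 i)//= lerD2l.
rewrite -{1}(card_ord n) -(cardC1 i) -sumr_const.
by apply: ler_sum => j _; exact: ct.
Qed.

Lemma measurable_simplex n c s : measurable (simplex n c s).
Proof.
rewrite (_ : simplex _ _ _ = box (fun _ : 'I_n => `[c, +oo[) `&`
    ((fun t => \sum_i (tnth t i : R)) @^-1` `]-oo, s])).
  apply: measurableI; first exact: measurable_box.
  rewrite -[X in measurable X]setTI; apply: measurable_sum => // i.
  exact: measurable_tnth.
apply/seteqP; split => t /= [ct ts]; split; rewrite ?in_itv//=.
- by move=> i; rewrite /= in_itv /= andbT.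
- by move=> i; have := ct i; rewrite /= in_itv /= andbT.
Qed.

Lemma lebesgue_simplex_fin n c s : (lebesgue_tuple R n (simplex n c s) < +oo)%E.
Proof.
apply: (@le_lt_trans _ _ (lebesgue_tuple R n (box (fun _ : 'I_n => `[c, s - c *+ n.-1])))).
  apply: le_measure; rewrite ?inE; last exact: simplex_sub_box.
    exact: measurable_simplex.
  exact: measurable_box.
rewrite (lebesgue_tuple_box (A := fun=> `[c, s - c *+ n.-1]%classic))//.
under eq_bigr do rewrite lebesgue_measure_itv /= -EFinB -(fun_if EFin).
by rewrite -(big_morph EFin EFinM erefl) ltry.
Qed.

Lemma measurable_meval n (p : mpoly n R) :
  measurable_fun setT (fun t : n.-tuple T => meval (tnth t) p).
Proof.
under eq_fun do rewrite mevalE.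
apply: measurable_sum => m; apply: measurable_funM => //.
apply: measurable_prod => i _; apply: measurable_funX.
exact: measurable_tnth.
Qed.

Lemma integrable_meval n (p : mpoly n R) c s :
  (lebesgue_tuple R n).-integrable (simplex n c s)
    (EFin \o (fun t => meval (tnth t) p)).
Proof.
apply: measurable_bounded_integrable; first exact: measurable_simplex.
- exact: lebesgue_simplex_fin.
- exact: measurable_funTS (measurable_meval p).
pose M : R := `|c| + `|s - c *+ n.-1|.
exists (\sum_(m <- msupp p) `|mcoeff m p| * \prod_i M ^+ m i).
split; first exact: num_real.
move=> x /ltW Mx t /simplex_sub_box tc /=; apply: le_trans Mx.
rewrite mevalE; apply: le_trans (ler_norm_sum _ _ _) _.
apply: ler_sum => m _; rewrite normrM ler_wpM2l// normr_prod.
apply: ler_prod => i _; rewrite normr_ge0 normrX /= lerXn2r ?nnegrE//.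
  by rewrite addr_ge0.
have := tc i; rewrite /= in_itv /= /M => /andP[h1 h2].
rewrite ler_norml; have := ler_norm (s - c *+ n.-1); have := ler_norm (- c).
have := normr_ge0 c; have := normr_ge0 (s - c *+ n.-1); rewrite normrN.
by move=> *; apply/andP; split; lra.
Qed.

Lemma continuous_meval n (p : mpoly n R) :
  continuous (fun v : 'rV[R]_n => meval (v 0) p).
Proof.
under eq_fun do rewrite mevalE.
apply: continuous_big => [|m _ v]; first exact: add_continuous.
have prodc : continuous (fun w : 'rV[R]_n => \prod_i w 0 i ^+ m i).
  apply: continuous_big => [|i _ w]; first exact: mul_continuous.
  exact: (continuous_comp (@coord_continuous R _ _ 0 i w) (@exprn_continuous R (m i) _)).
by apply: continuousM; [exact: cst_continuous|exact: prodc].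
Qed.

Lemma meval_neq0_near n (p : mpoly n R) (x : 'I_n -> R) : meval x p != 0 ->
  exists2 r : R, 0 < r &
    forall y, (forall i, `|x i - y i| < r) -> meval y p != 0.
Proof.
move=> px0; pose v (y : 'I_n -> R) := \row_i y i.
have ev y : meval (v y 0) p = meval y p by apply: meval_eq => i; rewrite mxE.
have : \forall w \near v x, meval ((w : 'rV[R]_n) 0) p != 0.
  by apply: (cvgr_neq0 (V := R) _ (@continuous_meval n p (v x))); rewrite ev.
move=> /nbhs_ballP[r /= r0 rp]; exists r => // y xy; rewrite -ev.
by apply: rp; split => // i j; rewrite !mxE; exact: xy.
Qed.

(** An interval of positive length contains an infinite grid. *)
Lemma mpoly_neq0_itv n (p : mpoly n R) (a b : R) : a < b -> p != 0 ->
  exists2 x, (forall i, a < x i < b) & meval x p != 0.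
Proof.
move=> ab p0; pose f (j : nat) := a + (b - a) / j.+2%:R.
have ba0 : 0 < b - a by rewrite subr_gt0.
have f_inj : injective f.
  move=> i j /addrI /(mulfI (lt0r_neq0 ba0)) /invr_inj /eqP.
  by rewrite eqr_nat => /eqP[].
have fab j : a < f j < b.
  rewrite /f ltrDl divr_gt0//= -ltrBrDl ltr_pdivrMr// ltr_pMr//.
  by rewrite ltr1n.
apply: contrapT => nx; case/eqP: p0; apply: (mpoly_eq0_grid f_inj) => e.
by apply: contrapT => /eqP pe; apply: nx; exists (fun i => f (e i)).
Qed.

(** A nonzero polynomial is nonzero somewhere in the open cube
    ]c, c + (s - n c) / (n + 1)[ ^ n, which the simplex contains, and then on a
    small box around that point.  Such a box has positive measure, whereas a
    nonnegative function of integral zero vanishes almost everywhere. *)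
Lemma mpoly_ge0_integral_eq0 n (p : mpoly n R) (c s : R) :
  c *+ n < s -> (forall t, simplex n c s t -> 0 <= meval (tnth t) p) ->
  \int[lebesgue_tuple R n]_(t in simplex n c s) meval (tnth t) p = 0 -> p = 0.
Proof.
move=> cs p_ge0 int0; apply/eqP/negPn/negP => p0.
have mS := @measurable_simplex n c s.
have : ae_eq (lebesgue_tuple R n) (simplex n c s)
         (EFin \o (fun t => meval (tnth t) p)) (cst 0%E).
  apply/ae_eq_integral_abs => //.
    by apply/measurable_EFinP; exact: measurable_funTS (measurable_meval p).
  transitivity (\int[lebesgue_tuple R n]_(t in simplex n c s)
                  (meval (tnth t) p)%:E)%E.
    by apply: eq_integral => t /set_mem /p_ge0 p0t /=; rewrite ger0_norm.
  apply/eqP; rewrite -fine_eq0 ?[fine _]int0//.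
  exact/integrable_fin_num/integrable_meval.
have d0 : c < c + (s - c *+ n) / n.+1%:R.
  by rewrite ltrDl divr_gt0// subr_gt0.
set b := c + _ in d0.
have [x xcb px] := mpoly_neq0_itv d0 p0.
have [r1 r10 r1p] := meval_neq0_near px.
have [r [r0 rr1 rcb]] : exists r, [/\ 0 < r, r <= r1 &
    forall i, c <= x i - r /\ x i + r <= b].
  pose m := \big[Num.min/r1]_i Num.min (x i - c) (b - x i).
  have mi i : m <= Num.min (x i - c) (b - x i).
    by rewrite /m (bigD1 i)//= ge_min lexx.
  exists m; split.
  - apply: lt_bigmin => // i _; rewrite lt_min !subr_gt0.
    by have /andP[-> ->] := xcb i.
  - exact: bigmin_le_id.
  - by move=> i; have := mi i; rewrite le_min => /andP[]; lra.
(* K is a box of side 2 r inside the simplex on which p has no zero, so it is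
   contained in the null set A. *)
pose I i : set T := `]x i - r, x i + r[.
have mI i : measurable (I i) by exact: measurable_itv.
pose K := box I.
have mK : measurable K.
  exact: measurable_box.
case=> A [mA A0 SA].
have KA : K `<=` A.
  move=> t Kt; apply: SA => /= pt.
  have ht i : x i - r < tnth t i < x i + r by have := Kt i; rewrite /I /= in_itv.
  suff /pt [pt0] : simplex n c s t.
    have /eqP := pt0; apply/negP; apply: r1p => i.
    have /andP[h1 h2] := ht i; apply: lt_le_trans rr1.
    by rewrite ltr_norml; apply/andP; split; lra.
  split=> [i|]; first by have /andP[h1 h2] := ht i; have [] := rcb i; lra.
  apply: (@le_trans _ _ (\sum_(i < n) b)).
    by apply: ler_sum => i _; have /andP[h1 h2] := ht i; have [] := rcb i; lra.
  rewrite sumr_const card_ord /b mulrnDl -lerBrDl -[leLHS]mulr_natl mulrCA.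
  rewrite ler_piMr ?subr_ge0 ?(ltW cs)// ler_pdivrMr// mul1r ler_nat.
  exact: leqnSn.
have : (lebesgue_tuple R n K <= 0)%E by rewrite -A0; apply: le_measure; rewrite ?inE.
apply/negP; rewrite -ltNge (lebesgue_tuple_box mI).
rewrite (eq_bigr (fun=> (r + r)%:E)) => [|i _]; last first.
  rewrite /I lebesgue_measure_itv /= lte_fin ifT; last by lra.
  by rewrite -EFinB; congr EFin; lra.
rewrite -(big_morph EFin EFinM erefl) lte_fin; apply: prodr_gt0 => i _; lra.
Qed.

End SimplexIntegral.
Arguments simplex {R} n c s.

(** * Unisolvence of the interior test functions of a simplex *)

(** The degrees of freedom test only against a basis; this passes to the whole
    test space. *)
Lemma basis_of_eq0 (K : fieldType) (V : vectType K) (B : seq V) (phi : V -> K) :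
  basis_of {: V} B -> (forall a u v, phi (a *: u + v) = a * phi u + phi v) ->
  {in B, forall b, phi b = 0} -> forall v, phi v = 0.
Proof.
move=> hB phiD phiB v; have phi0 : phi 0 = 0.
  by have := phiD (- 1) 0 0; rewrite scaler0 add0r mulN1r addNr.
have := memvf v; rewrite -(span_basis hB) -[B]in_tupleE => /coord_span ->.
elim/big_rec: _ => // i u _ phiu; rewrite phiD phiu addr0 phiB ?mulr0//.
exact: mem_nth.
Qed.

Section SimplexForms.
Variables (R : realType) (n : nat) (c s : R).
Hypothesis cs : c *+ n.+1 < s.

(** Up to a common positive factor, these are the barycentric coordinates of the
    simplex; [None] stands for the vertex with all coordinates equal to c,
    opposite to the facet \sum_m x m = s. *)
Definition simplex_form (i : option 'I_n.+1) : mpoly n.+1 R :=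
  if i is Some m then var m - mpolyC _ c else mpolyC _ s - \sum_m var m.

Lemma meval_simplex_form x i :
  meval x (simplex_form i) = if i is Some m then x m - c else s - \sum_m x m.
Proof.
case: i => [m|]; rewrite mevalB mevalC ?mevalXU//.
by congr (_ - _); rewrite raddf_sum; apply: eq_bigr => m _; exact: mevalXU.
Qed.

(** The vertices of the simplex: a form takes a nonzero value at exactly one
    of them. *)
Let vert (i : option 'I_n.+1) (m : 'I_n.+1) : R :=
  c + (if i == Some m then s - c *+ n.+1 else 0).

Let form_vert i j : meval (vert i) (simplex_form j) =
  if i == j then s - c *+ n.+1 else 0.
Proof.
rewrite meval_simplex_form /vert; case: j => [m|]; first by rewrite addrC addKr.
rewrite big_split /= sumr_const card_ord opprD addrA.
case: i => [m|] /=; last by rewrite big1 ?subr0.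
rewrite (bigD1 m)//= eqxx big1 ?addr0 ?subrr// => i im.
by case: eqP => // -[mi]; rewrite mi eqxx in im.
Qed.

Lemma msize_simplex_form i : msize (simplex_form i) = 2.
Proof.
have ij : exists j, j != i by case: i => [m|]; [exists None|exists (Some ord0)].
have [j ji] := ij; apply: (@msize_nonconstant _ _ _ (vert i) (vert j)).
  case: i {j ji ij} => [m|] /=; apply: rpredB; rewrite ?deg_leC ?deg_le_var//.
  by apply: rpred_sum => m _; apply: deg_le_var.
by rewrite !form_vert eqxx (negbTE ji) subr_eq0 gt_eqF.
Qed.

(** The coordinate hyperplanes are projected onto along the coordinate axes, the
    remaining one along the diagonal; the vertices separate the forms. *)
Lemma prod_simplex_form_dvd (p : mpoly n.+1 R) :
  (forall m x, x m = c -> meval x p = 0) ->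
  (forall x, \sum_m x m = s -> meval x p = 0) ->
  exists q, p = (\prod_i simplex_form i) * q.
Proof.
move=> pc ps.
pose w i (m : 'I_n.+1) : R := if i is Some m' then (m == m')%:R else - n.+1%:R^-1.
apply: (prod_dvd_mpoly (w := w)) => [i x|i j ij|i x].
- rewrite !meval_simplex_form; case: i => [m|] /=.
    by rewrite eqxx mul1r; ring.
  rewrite big_split /= sumr_const card_ord -[_ *+ n.+1]mulr_natr.
  have : n.+1%:R != 0 :> R by rewrite pnatr_eq0.
  by move: n.+1%:R => N N0; field.
- exists (vert i); rewrite form_vert.
    by rewrite (negbTE ij).
  by rewrite eqxx subr_eq0 gt_eqF.
- rewrite meval_simplex_form; case: i => [m|] /eqP; rewrite subr_eq0 => /eqP.
    exact: pc.
  by move=> /esym; exact: ps.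
Qed.

(** The quotient of p by the product of the forms has low enough degree to be a
    test function; tested against it, p becomes a nonnegative polynomial of
    integral zero. *)
Lemma simplex_unisolvent (k : nat) (j : int) (B : seq (Pol R n.+1 j))
    (p : mpoly n.+1 R) :
  j = k%:Z - n.+2%:Z -> basis_of {: Pol R n.+1 j} B -> p \in deg_le k ->
  (forall m x, x m = c -> meval x p = 0) ->
  (forall x, \sum_m x m = s -> meval x p = 0) ->
  (forall q, q \in B -> \int[lebesgue_tuple R n.+1]_(t in simplex n.+1 c s)
     (meval (tnth t) p * peval q (tnth t)) = 0) ->
  p = 0.
Proof.
move=> jk hB pk pc ps intB; have [q pq] := prod_simplex_form_dvd pc ps.
have [q0|qn0] := eqVneq q 0; first by rewrite pq q0 mulr0.
have qj : q \in deg_le j.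
  have := msize_prod_linear msize_simplex_form qn0.
  move: pk; rewrite -pq !deg_le_msize /= card_option card_ord => pk msp.
  have : (0 < msize q)%N by rewrite lt0n msize_poly_eq0.
  move: pk; rewrite msp jk; move: (mmeasure mdeg q) => d dk d0.
  have -> : k%:Z - n.+2%:Z = (k - n.+2)%N by lia.
  by rewrite /=; lia.
pose phi (r : Pol R n.+1 j) := \int[lebesgue_tuple R n.+1]_(t in simplex n.+1 c s)
   meval (tnth t) (p * val r).
have phi0 : forall r, phi r = 0.
  apply: (basis_of_eq0 hB) => [a u v|r rB]; last first.
    rewrite -[RHS](intB r rB); apply: eq_Rintegral => t _.
    by rewrite mevalM.
  rewrite /phi -RintegralZl; [|exact: measurable_simplex|exact: integrable_meval].
  rewrite -RintegralD; [|exact: measurable_simplex| |exact: integrable_meval].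
    by apply: eq_Rintegral => t _; rewrite !mevalM mevalD mevalZ; ring.
  rewrite (_ : _ \o _ = EFin \o (fun t => meval (tnth t) (a *: (p * val u)))).
    exact: integrable_meval.
  by apply/funext => t /=; rewrite mevalZ.
suff : p * q = 0 by move=> /eqP; rewrite mulf_eq0 (negbTE qn0) orbF => /eqP.
apply: (mpoly_ge0_integral_eq0 cs) (phi0 (MkPol qj)) => t [tc ts] /=.
rewrite pq -mulrA -expr2 mevalM rmorph_prod rmorphXn /= mulr_ge0 ?sqr_ge0//.
apply: prodr_ge0 => i _; rewrite meval_simplex_form.
by case: i => [m|]; rewrite subr_ge0.
Qed.

End SimplexForms.

(** * Barycentric coordinates and faces of the pentatope *)

Section Faces.
Variable R : realType.

(** Barycentric coordinates with respect to the vertices of the pentatope; they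
    are taken at arbitrary points, since the affine hulls of the faces are given
    by their vanishing. *)
Definition bary (x : 'I_4 -> R) (i : 'I_5) : R :=
  if unlift ord0 i is Some c then (x c + 1) / 2 else (- 2 - \sum_c x c) / 2.

Lemma sum_bary x : \sum_i bary x i = 1.
Proof.
rewrite big_ord_recl /bary unlift_none; under [X in _ + X]eq_bigr do rewrite liftK.
by rewrite -mulr_suml big_split /= sumr_const card_ord; lra.
Qed.

Lemma bary_inj x y : bary x =1 bary y -> x =1 y.
Proof. by move=> xy c; have := xy (lift ord0 c); rewrite /bary !liftK; lra. Qed.

Lemma bary_vertex i j : bary (vertex R i) j = (i == j)%:R.
Proof.
have vE c : vertex R i c = 2 * (i == lift ord0 c)%:R - 1.
  by rewrite /vertex; case: eqP => _ /=; lra.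
rewrite /bary; case: unliftP => [c|] ->; first by rewrite vE; lra.
have : \sum_(j < 5) (i == j)%:R = 1 :> R.
  rewrite (bigD1 i)//= eqxx big1 ?addr0// => k /negbTE.
  by rewrite eq_sym => ->.
rewrite big_ord_recl; under [in X in _ -> X]eq_bigr do rewrite vE.
by rewrite sumrB -mulr_sumr sumr_const card_ord /=; lra.
Qed.

Lemma bary_affine n (x : 'I_4 -> R) (v : 'I_n -> 'I_4 -> R) (a : 'I_n -> R) i :
  bary (fun c => x c + \sum_j a j * (v j c - x c)) i =
  bary x i + \sum_j a j * (bary (v j) i - bary x i).
Proof.
rewrite /bary; case: unliftP => [c|] _.
  rewrite [in RHS](eq_bigr (fun j => a j * (v j c - x c) / 2)) => [|j _]; last by field.
  by rewrite -mulr_suml; field.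
rewrite big_split /= exchange_big /=.
rewrite [in RHS](eq_bigr (fun j => - (\sum_c a j * (v j c - x c)) / 2)) => [|j _].
  by rewrite -mulr_suml sumrN; field.
by rewrite -mulr_sumr sumrB; field.
Qed.
End Faces.

(** The matrix determinant lemma: multiplying by unipotent block matrices turns
    the block triangular matrix with diagonal (1 + u v, 1) into the one with
    diagonal (1, 1 + v u). *)
Lemma det_add1_mul (K : comNzRingType) n (u : 'cV[K]_n) (v : 'rV[K]_n) :
  \det (1%:M + u *m v) = 1 + (v *m u) 0 0.
Proof.
have eqB : block_mx 1%:M 0 v 1%:M *m block_mx (1%:M + u *m v) u 0 1%:M *m
           block_mx 1%:M 0 (- v) 1%:M =
           block_mx (1%:M : 'M[K]_n) u 0 (1%:M + v *m u) :> 'M[K]_(n + 1).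
  rewrite !mulmx_block !mul1mx !mul0mx !mulmx0 !mulmx1 !addr0 !add0r.
  congr block_mx; first by rewrite mulmxN addrK.
    by rewrite mulmxN mulmxDl mul1mx mulmxDr mulmx1 mulmxA [v + _]addrC subrr.
  by rewrite addrC.
have := congr1 determinant eqB.
rewrite !det_mulmx !det_lblock !det_ublock !det1 !mul1r !mulr1 => ->.
by rewrite det_mx11 !mxE eqxx.
Qed.

Section FaceGeometry.
Variable R : realType.

Lemma size_enum_face d (F : face d) : size (enum (val F)) = d.+1.
Proof. by rewrite -cardE; exact/eqP/(valP F). Qed.

Lemma mem_face_vertex d (F : face d) i : (i < d.+1)%N -> face_vertex F i \in val F.
Proof. by move=> id; rewrite -mem_enum mem_nth ?size_enum_face. Qed.

Lemma eq_face_vertex d (F : face d) i j : (i < d.+1)%N -> (j < d.+1)%N ->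
  (face_vertex F i == face_vertex F j) = (i == j).
Proof. by move=> id jd; rewrite nth_uniq ?size_enum_face ?enum_uniq. Qed.

Lemma face_vertexP d (F : face d) a : a \in val F ->
  exists2 i, (i < d.+1)%N & a = face_vertex F i.
Proof.
move=> aF; exists (index a (enum (val F))).
  have : (index a (enum (val F)) < size (enum (val F)))%N.
    by rewrite index_mem mem_enum.
  by rewrite size_enum_face.
by rewrite /face_vertex nth_index ?mem_enum.
Qed.

(** The vertices of a face are listed in increasing order, so only the first can
    be vertex 0. *)
Lemma face_vertex_neq0 d (F : face d) i : (i < d)%N -> face_vertex F i.+1 != ord0.
Proof.
move=> id; have [F0|] := boolP (ord0 \in val F); last first.
  by apply: contraNneq => <-; exact: mem_face_vertex.
have -> : ord0 = face_vertex F 0.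
  by rewrite /face_vertex /enum_mem -enumT enum_ordSl /= F0.
by rewrite eq_face_vertex.
Qed.

(** The edge vectors are 2 e_a - 2 e_b for distinct canonical vectors e_a, with
    e_b replaced by 0 when the face contains vertex 0.  So the Gram matrix is
    4 (I + eps J), with J the matrix of ones and eps either 0 or 1, and its
    determinant is 4 ^ d (1 + eps d). *)
Lemma det_face_gram_gt0 d (F : face d) : 0 < \det (face_mx R F *m (face_mx R F)^T).
Proof.
pose e (a : 'I_5) c : R := (a == lift ord0 c)%:R.
have dot a a' : \sum_c e a c * e a' c = ((a == a') && (a != ord0))%:R.
  case: (unliftP ord0 a) => [c|] ->; last first.
    by rewrite andbF big1// => c _; rewrite /e mul0r.
  rewrite (bigD1 c)//= big1 => [|c' /negbTE c'c].
    by rewrite /e eqxx mul1r addr0 andbT eq_sym.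
  by rewrite /e (inj_eq lift_inj) eq_sym c'c mul0r.
pose eps : R := (face_vertex F 0 != ord0)%:R.
have -> : face_mx R F *m (face_mx R F)^T =
    4 *: (1%:M + (const_mx eps : 'cV_d) *m (const_mx 1 : 'rV_d)).
  apply/matrixP => i j; rewrite !mxE big_ord1 !mxE mulr1.
  transitivity (4 * \sum_c (e (face_vertex F i.+1) c * e (face_vertex F j.+1) c
     - e (face_vertex F i.+1) c * e (face_vertex F 0) c
     - e (face_vertex F j.+1) c * e (face_vertex F 0) c
     + e (face_vertex F 0) c * e (face_vertex F 0) c)).
    rewrite mulr_sumr; apply: eq_bigr => c _; rewrite !mxE.
    have vE a : vertex R a c = 2 * e a c - 1.
      by rewrite /vertex /e; case: eqP => _ /=; lra.
    by rewrite !vE; ring.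
  rewrite big_split !sumrB !dot /= eqxx !eq_face_vertex// ?ltnS//=.
  by rewrite face_vertex_neq0// andbT !subr0 eqSS.
rewrite detZ det_add1_mul mulr_gt0 ?exprn_gt0// mxE ltr_pwDl//.
by apply: sumr_ge0 => i _; rewrite !mxE mul1r ler0n.
Qed.

(** The parametrization [face_point] extended to arbitrary coordinate functions,
    so that it can be evaluated outside the standard simplex. *)
Definition face_map d (F : face d) (x : 'I_d -> R) (c : 'I_4) : R :=
  vertex R (face_vertex F 0) c + \sum_i x i * face_mx R F i c.

Lemma bary_face_map d (F : face d) x i :
  bary (face_map F x) i = (face_vertex F 0 == i)%:R +
   \sum_j x j * ((face_vertex F j.+1 == i)%:R - (face_vertex F 0 == i)%:R).
Proof.
pose v (j : 'I_d) := vertex R (face_vertex F j.+1).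
transitivity (bary (fun c => vertex R (face_vertex F 0) c +
   \sum_j x j * (v j c - vertex R (face_vertex F 0) c)) i).
  by congr bary; apply/funext => c; congr (_ + _); apply: eq_bigr => j _; rewrite mxE.
rewrite bary_affine bary_vertex; congr (_ + _).
by apply: eq_bigr => j _; rewrite bary_vertex.
Qed.

Lemma bary_face_map_notin d (F : face d) x i : i \notin val F ->
  bary (face_map F x) i = 0.
Proof.
move=> iF; have ni j : (j < d.+1)%N -> (face_vertex F j == i) = false.
  by move=> jd; apply: contraNF iF => /eqP <-; exact: mem_face_vertex.
rewrite bary_face_map ni// big1 ?addr0// => j _.
by rewrite !ni ?subrr ?mulr0// ltnS.
Qed.

Lemma bary_face_mapS d (F : face d) x (m : 'I_d) :
  bary (face_map F x) (face_vertex F m.+1) = x m.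
Proof.
rewrite bary_face_map eq_face_vertex ?ltnS//= add0r (bigD1 m)//= eqxx subr0 mulr1.
rewrite big1 ?addr0// => j jm.
by rewrite eq_face_vertex ?ltnS// eqSS (inj_eq val_inj) (negbTE jm) subr0 mulr0.
Qed.

Lemma bary_face_map0 d (F : face d) x :
  bary (face_map F x) (face_vertex F 0) = 1 - \sum_m x m.
Proof.
rewrite bary_face_map eqxx -sumrN; congr (_ + _); apply: eq_bigr => j _.
by rewrite eq_face_vertex ?ltnS//= sub0r mulrN1.
Qed.

Lemma face_map_onto d (F : face d) (y : 'I_4 -> R) :
  (forall i, i \notin val F -> bary y i = 0) -> exists x, face_map F x =1 y.
Proof.
move=> yF; pose x (m : 'I_d) := bary y (face_vertex F m.+1).
have eq_b i : i != face_vertex F 0 -> bary (face_map F x) i = bary y i.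
  move=> i0; have [/face_vertexP[[|m] md iE]|iF] := boolP (i \in val F).
  - by rewrite iE eqxx in i0.
  - by rewrite iE -[m]/(val (Ordinal (md : (m < d)%N))) bary_face_mapS.
  - by rewrite bary_face_map_notin// yF.
exists x; apply: bary_inj => i.
have [->|] := eqVneq i (face_vertex F 0); last exact: eq_b.
have := sum_bary y; rewrite -(sum_bary (face_map F x)).
rewrite [X in X = _ -> _](bigD1 (face_vertex F 0))//=.
rewrite [X in _ = X -> _](bigD1 (face_vertex F 0))//=.
by rewrite (eq_bigr _ eq_b) => /addIr.
Qed.

End FaceGeometry.

(** * Vanishing on the faces *)

Section Unisolvence.
Variable R : realType.

(** The points x range over the affine hull of the vertices in F, not only over
    the face that they span: divisibility by the equation of a hyperplane needs
    the vanishing on the whole hyperplane. *)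
Definition vanishes k (u : Pol R 4 k) (F : {set 'I_5}) :=
  forall x, (forall i, i \notin F -> bary x i = 0) -> peval u x = 0.

Lemma vanishes_vertex k (u : Pol R 4 k) i :
  peval u (vertex R i) = 0 -> vanishes u [set i].
Proof.
move=> ui x xi; rewrite -ui; apply: meval_eq; apply: bary_inj => j.
have xi1 : bary x i = 1.
  rewrite -(sum_bary x) (bigD1 i)//= big1 ?addr0// => m mi.
  by rewrite xi ?inE.
rewrite bary_vertex; have [<-|ji] := eqVneq i j; first by rewrite xi1.
by rewrite xi// inE eq_sym.
Qed.

(** The facet of F opposite to its vertex i is the zero set of the i-th
    barycentric coordinate, so the pullback of u to F satisfies the hypotheses of
    [simplex_unisolvent]; the positive Jacobian factor drops out of the
    equations. *)
Lemma vanishes_face n k (j : int) (F : face n.+1) (B : seq (Pol R n.+1 j))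
    (u : Pol R 4 k%:Z) :
  j = k%:Z - n.+2%:Z -> basis_of {: Pol R n.+1 j} B ->
  (forall q, q \in B -> face_integral F
     (fun t => peval u (face_point F t) * peval q (tnth t)) = 0) ->
  (forall i, i \in val F -> vanishes u (val F :\ i)) -> vanishes u (val F).
Proof.
move=> jk hB intB bdF y yF.
pose h c : mpoly n.+1 R := mpolyC _ (vertex R (face_vertex F 0) c) +
  \sum_m mpolyC _ (face_mx R F m c) * var m.
have evh x : meval x (subst h u) = peval u (face_map F x).
  rewrite meval_subst; apply: meval_eq => c.
  rewrite mevalD mevalC raddf_sum /=; congr (_ + _); apply: eq_bigr => m _.
  by rewrite mevalM mevalC mevalXU mulrC.
have [x xy] := face_map_onto yF.
rewrite -[LHS](meval_eq _ xy) -[LHS]evh.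
suff -> : subst h u = 0 by rewrite meval0.
have bd i z : i \in val F -> bary (face_map F z) i = 0 ->
    meval z (subst h u) = 0.
  move=> iF zi; rewrite evh; apply: (bdF i iF) => i'.
  rewrite !inE negb_and negbK => /orP[/eqP->//|]; exact: bary_face_map_notin.
apply: (simplex_unisolvent (c := 0) (s := 1) _ jk hB).
- by rewrite mul0rn ltr01.
- apply: deg_le_subst (valP u) => c; rewrite rpredD ?deg_leC//.
  apply: rpred_sum => m _.
  by rewrite mul_mpolyC; apply: rpredZ; exact: deg_le_var.
- move=> m z zm; apply: (bd (face_vertex F m.+1)).
    by apply: mem_face_vertex; rewrite ltnS.
  by rewrite bary_face_mapS.
- move=> z z1; apply: (bd (face_vertex F 0)); first exact: mem_face_vertex.
  by rewrite bary_face_map0 z1 subrr.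
move=> q /intB /eqP; rewrite /face_integral mulf_eq0.
rewrite gt_eqF ?sqrtr_gt0 ?det_face_gram_gt0//= => /eqP int0.
rewrite -[RHS]int0; apply: eq_Rintegral => t _.
by rewrite evh.
Qed.

Lemma pentatopeE : @pentatope R = simplex 4 (-1) (-2).
Proof.
apply/seteqP; split => x [xb xs]; split => // i.
  by have /andP[] := xb i.
have := simplex_sub_box (conj xb xs) i; rewrite /= in_itv /=.
by move=> /andP[-> h] /=; lra.
Qed.

Lemma vanishes_pentatope k (j : int) (B : seq (Pol R 4 j)) (u : Pol R 4 k%:Z) :
  j = k%:Z - 5 -> basis_of {: Pol R 4 j} B ->
  (forall q, q \in B -> \int[lebesgue_tuple R 4]_(x in @pentatope R)
     (peval u (tnth x) * peval q (tnth x)) = 0) ->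
  (forall i, vanishes u [set~ i]%SET) -> u = 0.
Proof.
rewrite pentatopeE => jk hB intB bd; apply: val_inj => /=.
have bd0 i x : bary x i = 0 -> meval x (val u) = 0.
  move=> xi; apply: (bd i) => i'.
  by rewrite !inE negbK => /eqP ->.
apply: (simplex_unisolvent _ jk hB (valP u) _ _ intB).
- by rewrite -mulr_natr; lra.
- move=> m x xm; apply: (bd0 (lift ord0 m)).
  by rewrite /bary liftK xm addNr mul0r.
- move=> x xs; apply: (bd0 ord0).
  by rewrite /bary unlift_none xs subrr mul0r.
Qed.

Lemma face_dofs_eq0 d (k j : int) (B : face d -> seq (Pol R d j))
    (u : Pol R 4 k) F q :
  all (fun l => l u == 0) (face_dofs k B) -> q \in B F ->
  face_integral F (fun t => peval u (face_point F t) * peval q (tnth t)) = 0.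
Proof.
move=> /all_allpairsP h qF; apply/eqP; exact: (h F q (mem_enum _ _) qF).
Qed.

End Unisolvence.

Theorem lemma4p4 (R : realType) (k : nat) (hk : (1 <= k)%N)
    (Be : face 1 -> seq (Pol R 1 (k%:Z - 2)))
    (Bf : face 2 -> seq (Pol R 2 (k%:Z - 3)))
    (BF : face 3 -> seq (Pol R 3 (k%:Z - 4)))
    (B : seq (Pol R 4 (k%:Z - 5)))
    (hBe : forall e, basis_of {: Pol R 1 (k%:Z - 2)} (Be e))
    (hBf : forall f, basis_of {: Pol R 2 (k%:Z - 3)} (Bf f))
    (hBF : forall F, basis_of {: Pol R 3 (k%:Z - 4)} (BF F))
    (hB : basis_of {: Pol R 4 (k%:Z - 5)} B) :
  @unisolvent R (Pol R 4 k%:Z) (trace_dofs Be Bf BF ++ vol_dofs B).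
Proof.
split; first exact: size_dofs.
move=> u; rewrite !all_cat -!andbA => /and5P[uv ue uf uF uB].
have step n (j : int) (Bn : face n.+1 -> seq (Pol R n.+1 j)) :
    j = k%:Z - n.+2%:Z -> (forall F, basis_of {: Pol R n.+1 j} (Bn F)) ->
    all (fun l => l u == 0) (face_dofs k Bn) ->
    (forall F : {set 'I_5}, #|F| = n.+1 -> vanishes u F) ->
    forall F : {set 'I_5}, #|F| = n.+2 -> vanishes u F.
  move=> jk hBn un bd F /eqP cF.
  apply: (@vanishes_face _ _ _ _ (exist _ F cF : face n.+1) _ _ jk (hBn _)) => [q|i iF].
    exact: face_dofs_eq0 un.
  by apply: bd; have := eqP cF; rewrite (cardsD1 i F) [i \in F]iF => -[].
have v1 (F : {set 'I_5}) : #|F| = 1%N -> vanishes u F.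
  move=> /eqP /cards1P[i ->]; apply: vanishes_vertex.
  by move: uv; rewrite /vertex_dofs all_map => /allP /(_ i (mem_enum _ _)) /eqP.
have v4 := step 2 _ _ erefl hBF uF (step 1 _ _ erefl hBf uf (step 0 _ _ erefl hBe ue v1)).
apply: (vanishes_pentatope erefl hB) => [q qB|i].
  move: uB; rewrite /vol_dofs all_map => /allP /(_ q qB) /eqP; exact.
by apply: v4; rewrite cardsC1 card_ord.
Qed.
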